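(* Let $A=S/I$ be an Artinian quotient of $S=\mathbb{K}[x_0,\ldots,x_r]$ by an ideal $I$ generated by quadratic monomials, and let $\Delta$ be the associated flag complex. Consider one of the following two situations. (Edge case) $e$ is an edge $\{v_p,v_q\}$ of $\Delta$, $\Delta'=\Delta\setminus \mathrm{st}(e)$, $\Delta''=\mathrm{lk}(e)$, $m=x_px_q$, and $s=2$. (Vertex case) $v_p$ is a vertex of $\Delta$, $\Delta'=\Delta\setminus \mathrm{st}(v_p)$, $\Delta''=\mathrm{lk}(v_p)$, $m=x_p$, and $s=1$. Let $A'=S/(I+\langle m\rangle)$ and $A''=S/(I:m)$ be the Artinian algebras corresponding to $\Delta'$ and $\Delta''$, let $\mu_i,\mu'_i,\mu''_i$ be the degree $i$ multiplication maps by $\ell$ on $A,A',A''$, and let $$\delta:\ker(\mu'_i)\longrightarrow \mathrm{coker}(\mu''_{i-s})$$ be the connecting homomorphism described in the context. Then: (1) $\mu_i$ is injective if both $\mu''_{i-s}$ and $\delta$ are injective (that is, $\mu''_{i-2}$ in the edge case, $\mu''_{i-1}$ in the vertex case). (2) $\mu_i$ is surjective if and only if both $\mu'_i$ and $\delta$ are surjective.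
   Context: $\mathbb{K}$ is a field. An Artinian quotient by an ideal $I$ generated by quadratic monomials has $x_0^2,\ldots,x_r^2\in I$, so $I=J'+J_\Delta$ where $J'=\langle x_0^2,\ldots,x_r^2\rangle$ and $J_\Delta$ is generated by squarefree quadratic monomials; $J_\Delta$ is the Stanley–Reisner ideal of a flag simplicial complex $\Delta$ on vertices $v_0,\ldots,v_r$ (with $v_i$ corresponding to $x_i$). For a face $\sigma\in\Delta$, $\mathrm{st}(\sigma)=\{\tau\in\Delta\mid\sigma\subseteq\tau\}$ (so $\Delta\setminus\mathrm{st}(\sigma)$ is the complex of faces not containing $\sigma$) and $\mathrm{lk}(\sigma)=\{\tau\in\Delta\mid \tau\cap\sigma=\emptyset,\ \tau\cup\sigma\in\Delta\}$ is the link. The Artinian algebra corresponding to a complex $\Gamma$ is the polynomial ring over $\mathbb{K}$ on the vertices of $\Gamma$ modulo the Stanley–Reisner ideal of $\Gamma$ plus the squares of the variables; it is isomorphic to $S/(I+\langle m\rangle)$ for $\Gamma=\Delta'$ and to $S/(I:m)$ for $\Gamma=\Delta''$. Let $\ell=x_0+\cdots+x_r$ (for quotients by monomial ideals this is a general linear form). Write $\mu_i:A_i\to A_{i+1}$, $\mu'_i:A'_i\to A'_{i+1}$, $\mu''_i:A''_i\to A''_{i+1}$ for multiplication by (the image of) $\ell$. The short exact sequence $0\to A''(-s)\xrightarrow{\cdot m}A\to A'\to 0$, taken in degrees $i$ and $i+1$, together with multiplication by $\ell$, is a commutative diagram with exact rows; the snake lemma yields the exact sequence $$0\to\ker\mu''_{i-s}\xrightarrow{\cdot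 m}\ker\mu_i\to\ker\mu'_i\xrightarrow{\ \delta\ }\mathrm{coker}\,\mu''_{i-s}\to\mathrm{coker}\,\mu_i\to\mathrm{coker}\,\mu'_i\to0,$$ where $\delta$ is the snake-lemma connecting homomorphism. *)

(* Defs.v *)
From HB Require Import structures.
From mathcomp Require Import all_boot all_order all_algebra.
From mathcomp Require Import ring_quotient.
From mathcomp Require Import boolp.
From mathcomp Require Import mpoly.
From mathcomp Require Import ring.

Set Implicit Arguments.
Unset Strict Implicit.
Unset Printing Implicit Defensive.

Import GRing.Theory.
Local Open Scope ring_scope.
Local Open Scope quotient_scope.

Section Modules.
Variable K : fieldType.
Implicit Types U V : lmodType K.

Record submodule V := Submodule { submodule_pred :> {pred V};
                                  submoduleP : submod_closed submodule_pred }.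

HB.instance Definition _ V (W : submodule V) :=
  GRing.isSubmodClosed.Build K V (submodule_pred W) (submoduleP W).

Record submod V (W : submodule V) : Type :=
  Submod { submod_val : V; submodP : submod_val \in W }.

HB.instance Definition _ V (W : submodule V) :=
  [isSub for @submod_val V W].
HB.instance Definition _ V (W : submodule V) :=
  [Choice of submod W by <:].
HB.instance Definition _ V (W : submodule V) :=
  [SubChoice_isSubLmodule of submod W by <:].

Lemma submod_valP V (W : submodule V) k (x y : submod W) :
  val (k *: x + y) = k *: val x + val y.
Proof. by []. Qed.

Definition quotmod V (W : submodule V) : Type := @Quotient.quot V W.

HB.instance Definition _ V (W : submodule V) :=
  EqQuotient.on (quotmod W).
HB.instance Definition _ V (W : submodule V) :=
  GRing.Zmodule.on (quotmod W).

Definition quotpi V (W : submodule V) (v : V) : quotmod W :=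
  \pi_(quotmod W) v.

Lemma quotpi_surj V (W : submodule V) (x : quotmod W) :
  exists v, x = quotpi W v.
Proof. by exists (repr x); rewrite /quotpi reprK. Qed.

Lemma eq_quotpi V (W : submodule V) u v :
  (quotpi W u = quotpi W v) <-> u - v \in W.
Proof.
split=> [|h].
  by move=> /eqP; rewrite /quotpi /quotmod -Quotient.idealrBE.
by apply/eqP; rewrite /quotpi /quotmod -Quotient.idealrBE.
Qed.

Lemma quotpi_is_zmod_morphism V (W : submodule V) :
  zmod_morphism (quotpi W).
Proof. exact: (raddfB (\pi_(@Quotient.quot V W))). Qed.

HB.instance Definition _ V (W : submodule V) :=
  GRing.isZmodMorphism.Build V (quotmod W) (quotpi W)
    (quotpi_is_zmod_morphism W).

Section Scale.
Variables (V : lmodType K) (W : submodule V).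

Definition quot_scale (k : K) (x : quotmod W) : quotmod W :=
  quotpi W (k *: repr x).

Lemma quot_scaleE k v : quot_scale k (quotpi W v) = quotpi W (k *: v).
Proof.
apply/eq_quotpi; rewrite -scalerBr; apply: (rpredZ (s := W)).
by apply/eq_quotpi; rewrite /quotpi reprK.
Qed.

Fact quot_scaleA a b x : quot_scale a (quot_scale b x) = quot_scale (a * b) x.
Proof. by have [v ->] := quotpi_surj x; rewrite !quot_scaleE scalerA. Qed.

Fact quot_scale1 : left_id 1 quot_scale.
Proof. by move=> x; have [v ->] := quotpi_surj x; rewrite quot_scaleE scale1r. Qed.

Fact quot_scaleDr : right_distributive quot_scale +%R.
Proof.
move=> a x y; have [u ->] := quotpi_surj x; have [v ->] := quotpi_surj y.
by rewrite -raddfD !quot_scaleE scalerDr raddfD.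
Qed.

Fact quot_scaleDl x : {morph quot_scale^~ x : a b / a + b}.
Proof.
by move=> a b; have [v ->] := quotpi_surj x; rewrite !quot_scaleE scalerDl raddfD.
Qed.

HB.instance Definition _ :=
  GRing.Zmodule_isLmodule.Build K (quotmod W)
    quot_scaleA quot_scale1 quot_scaleDr quot_scaleDl.

Fact quotpi_is_scalable : scalable (quotpi W).
Proof. by move=> k v; rewrite -quot_scaleE. Qed.

HB.instance Definition _ :=
  GRing.isScalable.Build K V (quotmod W) *:%R (quotpi W) quotpi_is_scalable.
End Scale.

Section KerCoker.
Variables (U V : lmodType K) (f : {linear U -> V}).

Definition ker_pred : {pred U} := fun u => f u == 0.
Fact ker_submod_closed : submod_closed ker_pred.
Proof.
split=> [|k u v]; first by rewrite unfold_in /ker_pred linear0.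
by rewrite !unfold_in /ker_pred linearP => /eqP-> /eqP->; rewrite scaler0 addr0.
Qed.
Definition kernel : submodule U := Submodule ker_submod_closed.

Definition im_pred : {pred V} := fun v => `[< exists u, f u = v >].
Fact im_submod_closed : submod_closed im_pred.
Proof.
split=> [|k u v]; first by apply/asboolP; exists 0; rewrite linear0.
move=> /asboolP[u' <-] /asboolP[v' <-]; apply/asboolP.
by exists (k *: u' + v'); rewrite linearP.
Qed.
Definition image : submodule V := Submodule im_submod_closed.
End KerCoker.
End Modules.

Notation ker f := (submod (kernel f)).
Notation coker f := (quotmod (image f)).

Definition surjective (T U : Type) (f : T -> U) : Prop :=
  forall y, exists x, f x = y.

Section Ideals.
Variables (K : fieldType) (S : comAlgType K).

Definition ideal_closed (I : {pred S}) : Prop :=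
  0 \in I /\ forall a, {in I &, forall u v, a * u + v \in I}.

Record ideal := Ideal { ideal_pred :> {pred S};
                        idealP : ideal_closed ideal_pred }.

Fact ideal_submod_closed (I : ideal) : submod_closed I.
Proof.
case: (idealP I) => I0 ID; split=> // k u v Iu Iv.
by rewrite -(mul1r u) scalerAl; apply: ID.
Qed.
Definition ideal_submodule (I : ideal) : submodule S :=
  Submodule (ideal_submod_closed I).

Lemma idealMl (I : ideal) a u : u \in I -> a * u \in I.
Proof.
by move=> Iu; rewrite -[a * u]addr0; apply: (idealP I).2 => //; case: (idealP I).
Qed.

Fact ideal_gen_closed (G : S -> Prop) : ideal_closed
  (fun p => `[< forall J : ideal, (forall g, G g -> g \in J) -> p \in J >]).
Proof.
split=> [|a u v /asboolP hu /asboolP hv]; apply/asboolP=> J GJ.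
  by case: (idealP J).
by apply: (idealP J).2; [exact: hu | exact: hv].
Qed.
(* the smallest ideal containing G *)
Definition ideal_gen G : ideal := Ideal (ideal_gen_closed G).

Fact ideal_add_closed (I : ideal) (f : S) : ideal_closed
  (fun p => `[< exists2 u, u \in I & exists v, p = u + v * f >]).
Proof.
split=> [|a x y /asboolP[u Iu [v ->]] /asboolP[u' Iu' [v' ->]]]; apply/asboolP.
  by exists 0; [case: (idealP I) | exists 0; rewrite mul0r addr0].
exists (a * u + u'); first exact: (idealP I).2.
by exists (a * v + v'); rewrite mulrDr mulrDl !mulrA addrACA.
Qed.
(* I + <f> *)
Definition ideal_add I f : ideal := Ideal (ideal_add_closed I f).

Fact ideal_colon_closed (I : ideal) (f : S) :
  ideal_closed (fun p => p * f \in I).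
Proof.
split=> [|a u v Iu Iv]; rewrite unfold_in.
  by rewrite mul0r; case: (idealP I).
by rewrite mulrDl -mulrA; apply: (idealP I).2.
Qed.
(* I : f *)
Definition ideal_colon I f : ideal := Ideal (ideal_colon_closed I f).

Section QuotientRing.
Variable I : ideal.

Definition quotring : Type := quotmod (ideal_submodule I).
HB.instance Definition _ := EqQuotient.on quotring.
HB.instance Definition _ := GRing.Lmodule.on quotring.

Definition qpi : S -> quotring := quotpi (ideal_submodule I).
HB.instance Definition _ := GRing.Linear.on qpi.

Lemma qpi_surj x : exists p, x = qpi p.
Proof. exact: quotpi_surj. Qed.

Lemma eq_qpi p q : (qpi p = qpi q) <-> p - q \in I.
Proof. exact: eq_quotpi. Qed.

Lemma qpi_repr x : qpi (repr x) = x.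
Proof. by rewrite /qpi /quotpi reprK. Qed.

Definition quot_mul (x y : quotring) : quotring := qpi (repr x * repr y).

Lemma quot_mulE p q : quot_mul (qpi p) (qpi q) = qpi (p * q).
Proof.
have h u : repr (qpi u) - u \in I by apply/eq_qpi; rewrite qpi_repr.
apply/eq_qpi.
have -> : repr (qpi p) * repr (qpi q) - p * q =
    repr (qpi p) * (repr (qpi q) - q) + q * (repr (qpi p) - p).
  by rewrite !mulrBr addrA [q * _]mulrC subrK [q * p]mulrC.
by apply: (idealP I).2; rewrite ?idealMl.
Qed.

Fact quot_mulA : associative quot_mul.
Proof.
move=> x y z; have [p ->] := qpi_surj x; have [q ->] := qpi_surj y.
by have [t ->] := qpi_surj z; rewrite !quot_mulE mulrA.
Qed.

Fact quot_mulC : commutative quot_mul.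
Proof. by move=> x y; rewrite /quot_mul mulrC. Qed.

Fact quot_mul1 : left_id (qpi 1) quot_mul.
Proof. by move=> x; have [p ->] := qpi_surj x; rewrite quot_mulE mul1r. Qed.

Fact quot_mulDl : left_distributive quot_mul +%R.
Proof.
move=> x y z; have [p ->] := qpi_surj x; have [q ->] := qpi_surj y.
by have [t ->] := qpi_surj z; rewrite -raddfD !quot_mulE mulrDl raddfD.
Qed.

HB.instance Definition _ := GRing.Zmodule_isComPzRing.Build quotring
  quot_mulA quot_mulC quot_mul1 quot_mulDl.

Lemma qpiM p q : qpi (p * q) = qpi p * qpi q.
Proof. by rewrite -quot_mulE. Qed.

Lemma qpiZ k p : qpi (k *: p) = k *: qpi p.
Proof. exact: linearZ. Qed.

Lemma qscalerAr k (x y : quotring) : k *: (x * y) = x * (k *: y).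
Proof.
have [p ->] := qpi_surj x; have [q ->] := qpi_surj y.
by rewrite -qpiM -!qpiZ -qpiM scalerAr.
Qed.
End QuotientRing.

(* The canonical surjection S/I -> S/(I + <f>). *)
Definition quot_proj I f (x : quotring I) : quotring (ideal_add I f) :=
  qpi (ideal_add I f) (repr x).

Lemma quot_projE I f p : quot_proj f (qpi I p) = qpi (ideal_add I f) p.
Proof.
apply/eq_qpi/asboolP; exists (repr (qpi I p) - p).
  by apply/eq_qpi; rewrite qpi_repr.
by exists 0; rewrite mul0r addr0.
Qed.

Fact quot_proj_is_linear I f : linear (@quot_proj I f).
Proof.
move=> k x y; have [p ->] := qpi_surj x; have [q ->] := qpi_surj y.
by rewrite -qpiZ -raddfD !quot_projE; exact: linearP.
Qed.

(* The map S/(I : f) -> S/I induced by multiplication by f. *)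
Definition quot_times I f (x : quotring (ideal_colon I f)) : quotring I :=
  qpi I (repr x * f).

Lemma quot_timesE I f p :
  quot_times (qpi (ideal_colon I f) p) = qpi I (p * f).
Proof.
apply/eq_qpi; rewrite -mulrBl.
suff: repr (qpi (ideal_colon I f) p) - p \in ideal_colon I f by [].
by apply/eq_qpi; rewrite qpi_repr.
Qed.

Fact quot_times_is_linear I f : linear (@quot_times I f).
Proof.
move=> k x y; have [p ->] := qpi_surj x; have [q ->] := qpi_surj y.
by rewrite -qpiZ -raddfD !quot_timesE mulrDl -scalerAl; exact: linearP.
Qed.
End Ideals.

Definition ring_ideal_closed (R : comPzRingType) (J : R -> Prop) : Prop :=
  J 0 /\ forall a u v, J u -> J v -> J (a * u + v).

(* descending chain condition on ideals *)
Definition artinian (R : comPzRingType) : Prop :=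
  forall J : nat -> R -> Prop,
    (forall n, ring_ideal_closed (J n)) ->
    (forall n x, J n.+1 x -> J n x) ->
    exists N, forall n, (N <= n)%N -> forall x, J N x -> J n x.

Section Graded.
Variables (K : fieldType) (n : nat).
Local Notation S := {mpoly K[n]}.
Implicit Types (I : ideal S) (d : int) (p q : S).

(* Degrees range over the integers, so that the pieces of negative degree,
   which occur in the shift A''(-s), are zero. *)
Definition homogz d p : bool :=
  if d is Posz k then p \is k.-homog else p == 0.

Fact homogz_closed d : submod_closed (homogz d).
Proof.
case: d => k; first exact: dhomog_submod_closed.
split=> [|c p q]; first by rewrite unfold_in /= eqxx.
by rewrite !unfold_in /= => /eqP-> /eqP->; rewrite scaler0 addr0.
Qed.

Definition grade_pred I d : {pred quotring I} :=
  fun a => `[< exists2 p, homogz d p & a = qpi I p >].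

Fact grade_closed I d : submod_closed (@grade_pred I d).
Proof.
have [h0 hD] := homogz_closed d.
split=> [|c a b /asboolP[p hp ->] /asboolP[q hq ->]]; apply/asboolP.
  by exists 0; rewrite ?linear0.
by exists (c *: p + q); [exact: hD | rewrite linearP].
Qed.

(* the degree d piece of S/I *)
Definition grade I d : submodule (quotring I) :=
  Submodule (grade_closed I d).

Definition ell : S := \sum_(j < n) 'X_j.

Lemma homogz_ell d p : homogz d p -> homogz (d + 1) (ell * p).
Proof.
case: d => [k|k] /=; last first.
  by move=> /eqP->; rewrite mulr0; case: k => [|k] /=; rewrite ?dhomog0 ?eqxx.
move=> hp; rewrite addn1 -add1n; apply: dhomogM hp.
by apply: rpred_sum => j _; rewrite dhomogX /= mdeg1.
Qed.

Fact mu_subproof I d (a : submod (grade I d)) :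
  qpi I ell * (val a : quotring I) \in grade I (d + 1).
Proof.
case: a => x /= /asboolP[p hp ->].
by apply/asboolP; exists (ell * p); rewrite ?qpiM ?homogz_ell.
Qed.

(* multiplication by ell from degree d to degree d + 1 *)
Definition mu I d (a : submod (grade I d)) : submod (grade I (d + 1)) :=
  Submod (mu_subproof a).

Fact mu_is_linear I d : linear (@mu I d).
Proof. by move=> c a b; apply: val_inj; rewrite /= mulrDr qscalerAr. Qed.

HB.instance Definition _ I d :=
  GRing.isLinear.Build K (submod (grade I d)) (submod (grade I (d + 1))) _
    (@mu I d) (@mu_is_linear I d).

(* the component of degree d *)
Definition pihz d p : S := if d is Posz k then pihomog mdeg k p else 0.

Fact pihz_is_linear d : linear (pihz d).
Proof. by case: d => k c p q; rewrite /pihz ?linearP // scaler0 addr0. Qed.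
HB.instance Definition _ d :=
  GRing.isLinear.Build K S S _ (pihz d) (pihz_is_linear d).

Lemma homogz_pihz d p : homogz d (pihz d p).
Proof. by case: d => k //=; exact: pihomogP. Qed.

Lemma pihz_id d p : homogz d p -> pihz d p = p.
Proof. by case: d => k /= => [/pihomog_dE|/eqP->]. Qed.

Lemma pihzX d g : pihz d 'X_[g] = if (mdeg g)%:Z == d then 'X_[g] else 0.
Proof. by case: d => k //=; rewrite pihomogX. Qed.

Lemma pihzMX d p g : pihz d (p * 'X_[g]) = pihz (d - (mdeg g)%:Z) p * 'X_[g].
Proof.
rewrite [p]mpolyE mulr_suml !linear_sum mulr_suml /=; apply: eq_bigr => h _.
rewrite -scalerAl !linearZ /= -scalerAl -mpolyXD !pihzX mdegD PoszD.
by rewrite eq_sym -subr_eq eq_sym; case: eqP; rewrite ?mul0r // mpolyXD.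
Qed.

Definition homog_ideal I := forall d p, p \in I -> pihz d p \in I.

Section Connecting.
Variables (I : ideal S) (f : S) (s : nat) (i : int).
Local Notation I' := (ideal_add I f).
Local Notation I'' := (ideal_colon I f).

(* The diagram chase of the snake lemma: c in A''_(i+1-s) is obtained from x in
   ker mu'_i by lifting x to a in A_i and writing ell * a as f * c. *)
Definition snake (x : ker (@mu I' i)) (c : submod (grade I'' (i - s%:Z + 1))) :=
  exists2 a : submod (grade I i),
    quot_proj f (val a : quotring I) = val (val x) &
    qpi I ell * (val a : quotring I) = quot_times (val c).

(* The connecting homomorphism ker mu'_i -> coker mu''_(i-s); when I is
   homogeneous and f is a monomial of degree s, the default value 0 is never
   used and the class does not depend on the chosen c: see snake_ex, deltaP. *)
Definition delta (x : ker (@mu I' i)) : coker (@mu I'' (i - s%:Z)) :=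
  quotpi (image (@mu I'' (i - s%:Z)))
    (if pselect (exists c, snake x c) is left h then sval (cid h) else 0).

Hypothesis homI : homog_ideal I.
Variable m : 'X_{1..n}.
Hypothesis fE : f = 'X_[m].
Hypothesis degm : mdeg m = s.

Lemma snake_ex x : exists c, snake x c.
Proof.
case: x => -[x0 /= px] kx.
have /asboolP[p hp ex] := px.
have ha : qpi I p \in grade I i by apply/asboolP; exists p.
have : ell * p \in I'.
  rewrite -[ell * p]subr0; apply/eq_qpi; rewrite qpiM -ex linear0.
  by move: kx; rewrite unfold_in => /eqP/(congr1 val).
move=> /asboolP[u Iu [v e]].
pose w := pihz (i + 1 - s%:Z) v.
have hw : qpi I'' w \in grade I'' (i - s%:Z + 1).
  by apply/asboolP; exists w => //; rewrite addrAC; exact: homogz_pihz.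
exists (Submod hw), (Submod ha); first by rewrite /= quot_projE.
rewrite /= quot_timesE -qpiM; apply/eq_qpi.
rewrite -(pihz_id (homogz_ell hp)) e fE linearD /= pihzMX degm addrK.
exact: homI.
Qed.

Lemma snake_uniq x c1 c2 : snake x c1 -> snake x c2 ->
  quotpi (image (@mu I'' (i - s%:Z))) c1 =
  quotpi (image (@mu I'' (i - s%:Z))) c2.
Proof.
case: c1 => c1 /= hc1; case: c2 => c2 /= hc2.
move=> [[a1 /= ha1] e1 f1] [[a2 /= ha2] e2 f2].
have /asboolP[p1 hp1 ea1] := ha1; have /asboolP[p2 hp2 ea2] := ha2.
have /asboolP[q1 _ ec1] := hc1; have /asboolP[q2 _ ec2] := hc2.
subst a1 a2 c1 c2; move: e1 f1 e2 f2.
rewrite /= !quot_projE !quot_timesE -!qpiM.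
move=> e0 /eq_qpi f1 e3 /eq_qpi f2.
move: e3; rewrite -e0 => /eq_qpi/asboolP[u Iu [v e]].
pose w := pihz (i - s%:Z) v.
have hw : qpi I'' w \in grade I'' (i - s%:Z).
  by apply/asboolP; exists w => //; exact: homogz_pihz.
have ep : p2 - p1 = pihz i u + w * f.
  by rewrite -(pihz_id hp1) -(pihz_id hp2) -linearB /= e fE linearD /= pihzMX degm.
apply/eq_quotpi/asboolP; exists (- Submod hw); apply: val_inj.
rewrite /= mulrN -qpiM -linearB -linearN /=; apply/eq_qpi.
rewrite unfold_in /=.
have -> : (- (ell * w) - (q1 - q2)) * f =
  1 * (ell * p1 - q1 * f) + (-1 * (ell * p2 - q2 * f) + ell * pihz i u).
  by move/(congr1 (fun z => z - w * f)): ep; rewrite addrK => <-; ring.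
have [_ ID] := idealP I.
apply: (ID 1 _ _ f1); apply: (ID (-1) _ _ f2); apply: idealMl; exact: homI.
Qed.

Lemma deltaP x c : snake x c ->
  delta x = quotpi (image (@mu I'' (i - s%:Z))) c.
Proof.
move=> sc; rewrite /delta; case: pselect => [h|[]]; last by exists c.
exact: snake_uniq (svalP (cid h)) sc.
Qed.

Lemma delta_is_linear : linear delta.
Proof.
move=> k x y; have [c sc] := snake_ex x; have [c' sc'] := snake_ex y.
rewrite (deltaP sc) (deltaP sc').
rewrite (deltaP (c := k *: c + c')); first exact: linearP.
case: sc sc' => [a e1 e2] [a' e1' e2']; exists (k *: a + a').
  rewrite !submod_valP -e1 -e1'; exact: quot_proj_is_linear.
rewrite !submod_valP; apply: etrans _ (esym (quot_times_is_linear k _ _)).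
apply: etrans (mulrDr _ _ _) _.
by rewrite -e2 -e2'; congr (_ + _); exact: esym (qscalerAr _ _ _).
Qed.
End Connecting.
End Graded.

Arguments mu {K n} I d a.
Arguments delta {K n} I f s i x.

Section MonomialIdeals.
Variables (K : fieldType) (n : nat).
Local Notation S := {mpoly K[n]}.
Implicit Types (I : ideal S) (p : S) (G : 'X_{1..n} -> Prop) (g h : 'X_{1..n}).

Definition monomial_ideal G : ideal S :=
  ideal_gen (fun p => exists2 g, G g & p = 'X_[g]).

Definition quadratic_monomial_ideal I : Prop :=
  exists2 G : 'X_{1..n} -> Prop,
    forall g, G g -> mdeg g = 2%N & I =i monomial_ideal G.

(* J_Delta, generated by the squarefree quadratic monomials in I *)
Definition squarefree_part I : ideal S :=
  monomial_ideal (fun g => exists j k : 'I_n,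
    [/\ j != k, g = (U_(j) + U_(k))%MM & 'X_[g] \in I]).

(* mesym1 sigma is the exponent of the product of the x_j, j in sigma. *)
Definition flag_complex I : {set {set 'I_n}} :=
  [set sigma : {set 'I_n} | 'X_[mesym1 sigma] \notin squarefree_part I].

Definition deletion (D : {set {set 'I_n}}) (sigma : {set 'I_n}) :=
  [set tau in D | ~~ (sigma \subset tau)].

Definition link (D : {set {set 'I_n}}) (sigma : {set 'I_n}) :=
  [set tau in D | [disjoint tau & sigma] && (tau :|: sigma \in D)].

(* The squares of the variables plus the Stanley-Reisner ideal of D, in the
   polynomial ring on all of x_0, ..., x_r: the variables which are not vertices
   of D are among its generators. *)
Definition artinian_ideal (D : {set {set 'I_n}}) : ideal S :=
  monomial_ideal (fun g => (exists j : 'I_n, g = (U_(j) *+ 2)%MM) \/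
    exists2 sigma : {set 'I_n}, sigma \notin D & g = mesym1 sigma).

Inductive situation (D : {set {set 'I_n}}) :
  {set {set 'I_n}} -> {set {set 'I_n}} -> S -> nat -> Prop :=
| EdgeCase (p q : 'I_n) : p != q -> [set p; q] \in D ->
    situation D (deletion D [set p; q]) (link D [set p; q]) ('X_p * 'X_q) 2
| VertexCase (p : 'I_n) : [set p] \in D ->
    situation D (deletion D [set p]) (link D [set p]) 'X_p 1.

Lemma mideal_gen G g h : G g -> (g <= h)%MM -> 'X_[h] \in monomial_ideal G.
Proof.
move=> Gg /submK <-; rewrite mpolyXD; apply: idealMl.
by apply/asboolP => J; apply; exists g.
Qed.

Fact support_closed G : ideal_closed (fun p : S =>
  `[< forall h, h \in msupp p -> exists2 g, G g & (g <= h)%MM >]).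
Proof.
split=> [|a u v /asboolP hu /asboolP hv]; apply/asboolP=> h.
  by rewrite msupp0.
move=> /msuppD_le; rewrite mem_cat => /orP[|/hv//].
move=> /msuppM_le/allpairsP[[h1 h2] /= [_ /hu[g Gg le_g] ->]].
by exists g => //; apply: lepm_trans le_g (lem_addl _ _).
Qed.

Lemma midealP G p : reflect
  (forall h, h \in msupp p -> exists2 g, G g & (g <= h)%MM)
  (p \in monomial_ideal G).
Proof.
apply: (iffP idP) => [/asboolP/(_ (Ideal (support_closed G))) H|H].
  apply/asboolP; apply: H => _ [g Gg ->]; apply/asboolP => h.
  by rewrite msuppX inE => /eqP->; exists g => //; exact: lepm_refl.
rewrite [p]mpolyE big_seq; apply: (big_ind (fun q => q \in _)).
- by case: (idealP (monomial_ideal G)).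
- move=> q t hq ht; rewrite -[q]mul1r.
  by have [_ ID] := idealP (monomial_ideal G); apply: ID.
move=> h /H[g Gg le_g]; rewrite -mul_mpolyC; apply: idealMl.
exact: mideal_gen le_g.
Qed.

Lemma midealXP G h : reflect (exists2 g, G g & (g <= h)%MM)
  ('X_[h] \in monomial_ideal G).
Proof.
apply: (iffP (midealP _ _)) => [|H k]; last first.
  by rewrite msuppX inE => /eqP->.
by apply; rewrite msuppX inE.
Qed.

Lemma mideal_suppP G p : reflect
  (forall h, h \in msupp p -> 'X_[h] \in monomial_ideal G)
  (p \in monomial_ideal G).
Proof.
by apply: (iffP (midealP _ _)) => H h /H => [?|/midealXP]; [apply/midealXP|].
Qed.

Lemma homog_mideal G I : I =i monomial_ideal G -> homog_ideal I.
Proof.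
move=> eI d p; rewrite !eI => /mideal_suppP hp; apply/mideal_suppP => h.
case: d => k /=; last by rewrite msupp0.
rewrite mcoeff_msupp => hk; apply: hp; rewrite mcoeff_msupp.
apply: contraNneq hk => h0; rewrite pihomogE raddf_sum /= big1 // => g _.
by rewrite mcoeffZ mcoeffX; case: eqP => [->|_]; rewrite ?h0 ?mul0r ?mulr0.
Qed.

Lemma mdeg2P g : mdeg g = 2%N -> exists j k : 'I_n, g = (U_(j) + U_(k))%MM.
Proof.
move=> g2; have : g != 0%MM by rewrite -mdeg_eq0 g2.
case: (altP (@forallP _ (fun j => g j == 0%N))) => [g0|].
  by case/eqP; apply/mnmP => j; rewrite mnm0E; apply/eqP.
rewrite negb_forall => /existsP[j gj] _.
have e : g = (g - U_(j) + U_(j))%MM by rewrite submK // lep1mP.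
have : mdeg (g - U_(j)) == 1%N.
  by move: g2; rewrite {1}e mdegD mdeg1 addn1 => -[->].
by move=> /mdeg1P[k /eqP ek]; exists k, j; rewrite e ek.
Qed.

Lemma sub_mesym1 (s t : {set 'I_n}) : s \subset t -> (mesym1 s <= mesym1 t)%MM.
Proof.
move=> /subsetP st; apply/mnm_lepP => j; rewrite !mnmE.
by case: (boolP (j \in s)) => // /st->.
Qed.

Lemma pair_mesym1 (j k : 'I_n) (s : {set 'I_n}) :
  j != k -> j \in s -> k \in s -> (U_(j) + U_(k) <= mesym1 s)%MM.
Proof.
move=> jk js ks; apply/mnm_lepP => i; rewrite mnmDE !mnm1E mnmE.
case: eqP => [<-|_]; first by rewrite js eq_sym (negbTE jk).
by case: eqP => [<-|_]; rewrite ?ks.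
Qed.

Section Quadratic.
Variable I : ideal S.
Hypothesis quadI : quadratic_monomial_ideal I.

Lemma quad_homog : homog_ideal I.
Proof. by case: quadI => G _ /homog_mideal. Qed.

Lemma quad_suppP p : reflect
  (forall h, h \in msupp p -> 'X_[h] \in I) (p \in I).
Proof.
apply: (iffP idP); case: quadI => G _ eI; rewrite eI.
  by move=> /mideal_suppP H h /H; rewrite eI.
by move=> H; apply/mideal_suppP => h /H; rewrite eI.
Qed.

Lemma quadXP h : reflect
  (exists j k, (U_(j) + U_(k) <= h)%MM /\ 'X_[U_(j) + U_(k)] \in I)
  ('X_[h] \in I).
Proof.
apply: (iffP idP) => [|[j [k [le_h Ijk]]]]; last first.
  by rewrite -(submK le_h) mpolyXD; apply: idealMl.
case: quadI => G degG eI.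
rewrite eI => /midealXP[g Gg le_g]; have [j [k e]] := mdeg2P (degG _ Gg).
exists j, k; rewrite -e; split=> //; rewrite eI.
exact: mideal_gen Gg (lepm_refl _).
Qed.

Hypothesis artI : artinian (quotring I).

Lemma artinian_sqr (j : 'I_n) : 'X_[U_(j) *+ 2] \in I.
Proof.
pose J (k : nat) (a : quotring I) := exists b, a = b * qpi I ('X_j ^+ k).
have [|k x [b ->]|N /(_ N.+1 (leqnSn N))] := artI (J := J).
- move=> k; split=> [|a _ _ [b ->] [c ->]]; first by exists 0; rewrite mul0r.
  by exists (a * b + c); rewrite mulrDl mulrA.
- by exists (b * qpi I 'X_j); rewrite -mulrA -qpiM -exprS.
move=> /(_ (qpi I ('X_j ^+ N))) []; first by exists 1; rewrite mul1r.
move=> b; have [p ->] := qpi_surj b; rewrite -qpiM => /eq_qpi/quad_suppP.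
move=> /(_ (U_(j) *+ N)%MM); rewrite exprS mulrA !mpolyXn.
rewrite mcoeff_msupp mcoeffB mcoeffX eqxx.
have -> : (p * 'X_j * 'X_[U_(j) *+ N])@_(U_(j) *+ N) = 0.
  rewrite -[X in _@_X]addm0 mcoeffMX.
  apply/eqP; rewrite -[_ == 0]negbK -mcoeff_msupp.
  apply/negP => /msuppM_le/allpairsP[[h1 h2] /= [_]].
  rewrite msuppX inE => /eqP-> /eqP; rewrite eq_sym mnmD_eq0.
  by rewrite mnm1_eq0 andbF.
rewrite subr0 oner_neq0 => /(_ isT)/quadXP[k [l [le_N Ikl]]].
have eqj (i : 'I_n) : (U_(i) <= U_(j) *+ N)%MM -> i = j.
  by rewrite lep1mP mulmnE mnm1E; case: (j =P i) => // _; rewrite mul0n.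
have ek := eqj k (lepm_trans (lem_addr _ _) le_N).
have el := eqj l (lepm_trans (lem_addl _ _) le_N).
by move: Ikl; rewrite ek el.
Qed.

Lemma flag_complexPn (sigma : {set 'I_n}) : reflect
  (exists j k, [/\ j != k, j \in sigma, k \in sigma & 'X_[U_(j) + U_(k)] \in I])
  (sigma \notin flag_complex I).
Proof.
rewrite inE negbK; apply: (iffP (midealXP _ _)) => [[_ [j [k [jk -> Ijk]]] le_s]|].
  exists j, k; split=> //.
    by have := lepm_trans (lem_addr _ _) le_s; rewrite lep1mP mnmE; case: (j \in _).
  by have := lepm_trans (lem_addl _ _) le_s; rewrite lep1mP mnmE; case: (k \in _).
move=> [j [k [jk js ks Ijk]]]; exists (U_(j) + U_(k))%MM; first by exists j, k.
exact: pair_mesym1.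
Qed.

Variable e : {set 'I_n}.
Local Notation Xe := ('X_[mesym1 e] : S).

Let quad_le (g h : 'X_{1..n}) : (g <= h)%MM -> 'X_[g] \in I -> 'X_[h] \in I.
Proof. by move=> /submK <- Ig; rewrite mpolyXD; apply: idealMl. Qed.

Let nonface (s : {set 'I_n}) : s \notin flag_complex I -> 'X_[mesym1 s] \in I.
Proof.
move=> /flag_complexPn[j [k [jk js ks]]]; apply: quad_le.
exact: pair_mesym1.
Qed.

Lemma deletion_ideal :
  ideal_add I Xe =i artinian_ideal (deletion (flag_complex I) e).
Proof.
move=> p; apply/idP/idP => [/asboolP[u Iu [v ->]]|/asboolP/(_ (ideal_add I Xe)) H].
  have [_ AD] := idealP (artinian_ideal (deletion (flag_complex I) e)).
  rewrite addrC; apply: AD.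
    apply: mideal_gen (lepm_refl _); right; exists e => //.
    by rewrite inE subxx andbF.
  apply/mideal_suppP => h /(elimT (quad_suppP _) Iu)/quadXP[j [k [le_h Ijk]]].
  case: (eqVneq j k) le_h Ijk => [->|jk] le_h Ijk.
    by apply: mideal_gen le_h; left; exists k.
  apply: (mideal_gen (g := mesym1 [set j; k])); last first.
    apply: lepm_trans le_h; apply/mnm_lepP => i; rewrite mnmDE !mnm1E mnmE !inE.
    by rewrite ![i == _]eq_sym; do 2 case: (_ == i).
  right; exists [set j; k] => //; rewrite inE negb_and; apply/orP; left.
  by apply/flag_complexPn; exists j, k; rewrite !inE !eqxx orbT.
apply: H => _ [g + ->]; case=> [[j ->]|[s hs ->]]; apply/asboolP.
  by exists 'X_[U_(j) *+ 2]; [exact: artinian_sqr|exists 0; rewrite mul0r addr0].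
move: hs; rewrite inE negb_and negbK => /orP[/nonface Is|/sub_mesym1/submK <-].
  by exists 'X_[mesym1 s] => //; exists 0; rewrite mul0r addr0.
exists 0; first by case: (idealP I).
by exists 'X_[mesym1 s - mesym1 e]; rewrite add0r mpolyXD.
Qed.

Lemma link_ideal :
  ideal_colon I Xe =i artinian_ideal (link (flag_complex I) e).
Proof.
move=> p; apply/idP/idP => [Ip|/asboolP/(_ (ideal_colon I Xe)) H].
  apply/mideal_suppP => h hp.
  have /quadXP[j [k [le_h Ijk]]] : 'X_[mesym1 e + h] \in I.
    by apply: (elimT (quad_suppP _) Ip); rewrite mcoeff_msupp mcoeffMX -mcoeff_msupp.
  pose s := [set i | h i != 0%N].
  have le_s : (mesym1 s <= h)%MM.
    by apply/mnm_lepP => i; rewrite mnmE inE; case: (h i).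
  case: (boolP (s \notin link (flag_complex I) e)) => [hs|/negPn].
    by apply: mideal_gen le_s; right; exists s.
  rewrite inE => /and3P[_ dis hse].
  case: (eqVneq j k) le_h Ijk => [->|jk] le_h Ijk.
    apply: (mideal_gen (g := (U_(k) *+ 2)%MM)); first by left; exists k.
    apply/mnm_lepP => i; have /mnm_lepP/(_ i) := le_h.
    rewrite mulmnE !mnmDE !mnm1E mnmE; case: eqP => // <-.
    case: (boolP (k \in e)) => // ke.
    by have := disjointFl dis ke; rewrite inE => /negbFE/eqP->.
  suff: s :|: e \notin flag_complex I by rewrite hse.
  apply/flag_complexPn.
  have in_se i : (U_(i) <= mesym1 e + h)%MM -> i \in s :|: e.
    by rewrite lep1mP mnmDE mnmE !inE; case: (i \in e); rewrite ?orbT ?orbF.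
  exists j, k; split=> //; apply: in_se.
    exact: lepm_trans (lem_addr _ _) le_h.
  exact: lepm_trans (lem_addl _ _) le_h.
apply: H => _ [g + ->]; case=> [[j ->]|[s hs ->]].
  by rewrite unfold_in /= mulrC; apply: idealMl; exact: artinian_sqr.
rewrite unfold_in /= -mpolyXD.
have [dis|/pred0Pn[i /andP[/= si ei]]] := boolP [disjoint s & e]; last first.
  apply: quad_le (artinian_sqr i); apply/mnm_lepP => j.
  by rewrite mulmnE mnmDE mnm1E !mnmE; case: eqP => // <-; rewrite si ei.
move: hs; rewrite inE dis /= negb_and => /orP[] /nonface.
  exact/quad_le/lem_addr.
apply: quad_le; apply/mnm_lepP => j; rewrite mnmDE !mnmE inE.
by case: (j \in s); case: (j \in e).
Qed.
End Quadratic.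

(* S/(I + <f>) and S/(I : f) are the Artinian algebras of D' and D''. *)
Lemma situation_ideals I D' D'' (f : S) s :
  quadratic_monomial_ideal I -> artinian (quotring I) ->
  situation (flag_complex I) D' D'' f s ->
  ideal_add I f =i artinian_ideal D' /\ ideal_colon I f =i artinian_ideal D''.
Proof.
move=> qI aI [p q pq _|p _]; last first.
  by rewrite -mesym1_set1; split; [exact: deletion_ideal|exact: link_ideal].
have -> : 'X_p * 'X_q = 'X_[mesym1 [set p; q]] :> S.
  rewrite -mpolyXD; congr 'X_[_]; apply/mnmP => i.
  rewrite mnmDE !mnm1E mnmE !inE ![i == _]eq_sym.
  case: (p =P i) => [ep|_]; case: (q =P i) => [eq|_] //.
  by rewrite ep eq eqxx in pq.
by split; [exact: deletion_ideal|exact: link_ideal].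
Qed.
End MonomialIdeals.

(* Main.v *)
From HB Require Import structures.
Require Import Defs.
From mathcomp Require Import all_boot all_order all_algebra.
From mathcomp Require Import boolp.
From mathcomp Require Import mpoly.
From mathcomp Require Import ring.
Import GRing.Theory.
Local Open Scope ring_scope.

(** Both claims are diagram chases in the snake diagram of
    [0 -> A''(-s) -> A -> A' -> 0], with horizontal maps [quot_times] and
    [quot_proj]. The sequence is exact in each degree because [I] is homogeneous
    and [m] is a monomial of degree [s]. *)

Section ShortExactSequence.
Set Implicit Arguments.
Unset Strict Implicit.
Variables (K : fieldType) (S : comAlgType K) (I : ideal S) (f : S).
Local Notation I' := (ideal_add I f).
Local Notation I'' := (ideal_colon I f).

HB.instance Definition _ := GRing.isLinear.Build K (quotring I) (quotring I') _
  (@quot_proj K S I f) (@quot_proj_is_linear K S I f).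
HB.instance Definition _ := GRing.isLinear.Build K (quotring I'') (quotring I) _
  (@quot_times K S I f) (@quot_times_is_linear K S I f).

Lemma quot_projMl p (x : quotring I) :
  quot_proj f (qpi I p * x) = qpi I' p * quot_proj f x.
Proof. by have [q ->] := qpi_surj x; rewrite -qpiM !quot_projE qpiM. Qed.

Lemma quot_timesMl p (x : quotring I'') :
  quot_times (qpi I'' p * x) = qpi I p * quot_times x.
Proof. by have [q ->] := qpi_surj x; rewrite -qpiM !quot_timesE -mulrA qpiM. Qed.

(** Left exactness is the definition of the colon ideal: [(p - q) * f] lies in [I] exactly when
    [p - q] lies in [I'']. *)
Lemma quot_times_inj : injective (@quot_times K S I f).
Proof.
move=> x y; have [p ->] := qpi_surj x; have [q ->] := qpi_surj y.
by rewrite !quot_timesE => /eq_qpi; rewrite -mulrBl => h; apply/eq_qpi.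
Qed.

Lemma quot_proj_times (c : quotring I'') : quot_proj f (quot_times c) = 0.
Proof.
have [p ->] := qpi_surj c; rewrite quot_timesE quot_projE -(linear0 (qpi I')).
apply/eq_qpi/asboolP; exists 0; first by case: (idealP I).
by exists p; rewrite subr0 add0r.
Qed.
End ShortExactSequence.

Section GradedExactness.
Set Implicit Arguments.
Unset Strict Implicit.
Variables (K : fieldType) (n : nat) (I : ideal {mpoly K[n]}) (g : 'X_{1..n}).
Local Notation f := ('X_[g] : {mpoly K[n]}).
Local Notation s := ((mdeg g)%:Z).
Local Notation I' := (ideal_add I f).
Local Notation I'' := (ideal_colon I f).

Lemma quot_proj_grade d x : x \in grade I d -> quot_proj f x \in grade I' d.
Proof.
by move=> /asboolP[p hp ->]; rewrite quot_projE; apply/asboolP; exists p.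
Qed.

Lemma quot_proj_grade_surj d y : y \in grade I' d ->
  exists2 x, x \in grade I d & quot_proj f x = y.
Proof.
move=> /asboolP[p hp ->]; exists (qpi I p); last exact: quot_projE.
by apply/asboolP; exists p.
Qed.

Lemma quot_times_grade d c :
  c \in grade I'' (d - s) -> quot_times c \in grade I d.
Proof.
move=> /asboolP[p hp ->]; rewrite quot_timesE; apply/asboolP.
(* Writing [p] as its own component of degree [d - s] also covers negative [d - s] without a case
   split. *)
exists (p * f) => //; rewrite -(pihz_id hp) -pihzMX; exact: homogz_pihz.
Qed.

(** Middle exactness, degree by degree. From [p = u + v * f] with [u] in [I], take components of
    degree [d]: that of [u] stays in [I] by homogeneity, and that of [v * f] is [f] times the
    component of [v] of degree [d - s]. *)
Lemma quot_proj_grade_ker d x : homog_ideal I ->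
  x \in grade I d -> quot_proj f x = 0 ->
  exists2 c, c \in grade I'' (d - s) & x = quot_times c.
Proof.
move=> homI /asboolP[p hp ->]; rewrite quot_projE -(linear0 (qpi I')).
move=> /eq_qpi/asboolP[u Iu [v]]; rewrite subr0 => e.
exists (qpi I'' (pihz (d - s) v)).
  by apply/asboolP; exists (pihz (d - s) v) => //; exact: homogz_pihz.
rewrite quot_timesE -pihzMX -[p](pihz_id hp) e linearD.
by apply/eq_qpi; rewrite addrK; exact: homI.
Qed.
End GradedExactness.

Section SnakeSequence.
Set Implicit Arguments.
Unset Strict Implicit.
Variables (K : fieldType) (n : nat) (I : ideal {mpoly K[n]}) (g : 'X_{1..n}).
Variable i : int.
Hypothesis homI : homog_ideal I.
Local Notation f := ('X_[g] : {mpoly K[n]}).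
Local Notation s := ((mdeg g)%:Z).
Local Notation I' := (ideal_add I f).
Local Notation I'' := (ideal_colon I f).
Local Notation delta := (delta I f (mdeg g) i).

(** [mu I'' (i - s)] lands in degree [i - s + 1], while exactness in degree [i + 1] yields
    [i + 1 - s]. *)
Let degS : i - s + 1 = i + 1 - s. Proof. exact: addrAC. Qed.

(** [delta] is defined by choice; any single chase through the diagram suffices to compute it. *)
Lemma delta_snake x c :
  @snake K n I f (mdeg g) i x c ->
  delta x = quotpi (Defs.image (mu I'' (i - s))) c.
Proof. exact: (deltaP homI (erefl _) (erefl _)). Qed.

Lemma mu_inj_of_delta : injective (mu I'' (i - s)) -> injective delta ->
  injective (mu I i).
Proof.
move=> inj'' injd; apply: raddf_inj => -[a ha] /(congr1 val) /= mua0.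
have ker_a : Submod (quot_proj_grade _ ha) \in kernel (mu I' i).
  by apply/eqP/val_inj; rewrite /= -quot_projMl mua0 linear0.
have : Submod ker_a = 0.
  (* Both values of [delta] are the class of [0]: lift the first argument to [a], where
     [ell * a = 0], and the argument [0] to [0]. *)
  apply: injd; rewrite (delta_snake (c := 0)); last first.
    by exists (Submod ha) => //=; rewrite mua0 linear0.
  rewrite (delta_snake (c := 0)) //.
  by exists 0; rewrite /= ?mulr0 ?linear0.
move=> /(congr1 (fun z => val (val z))) /= proj_a0.
have [c hc ea] := quot_proj_grade_ker homI ha proj_a0.
(* Since [a = f * c], injectivity of [quot_times] turns [ell * a = 0] into [ell * c = 0]. *)
have /(congr1 val) /= c0 : Submod hc = 0.
  apply: inj''; apply: val_inj; apply: quot_times_inj.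
  by rewrite linear0 /= quot_timesMl -ea mua0 linear0.
by apply: val_inj; rewrite /= ea c0 linear0.
Qed.

Lemma mu_add_surj : surjective (mu I i) -> surjective (mu I' i).
Proof.
move=> sur [y hy]; have [x hx ex] := quot_proj_grade_surj hy.
have [[a ha] /(congr1 val) /= ea] := sur (Submod hx).
exists (Submod (quot_proj_grade _ ha)); apply: val_inj.
by rewrite /= -quot_projMl ea ex.
Qed.

Lemma delta_surj : surjective (mu I i) -> surjective delta.
Proof.
move=> sur z; have [[c hc] ->] := quotpi_surj z.
have htc : quot_times c \in grade I (i + 1).
  by apply: quot_times_grade; rewrite -degS.
have [[a ha] /(congr1 val) /= ea] := sur (Submod htc).
have ker_a : Submod (quot_proj_grade _ ha) \in kernel (mu I' i).
  by apply/eqP/val_inj; rewrite /= -quot_projMl ea quot_proj_times.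
(* The preimage [a] of [f * c] is itself the lift required by the chase. *)
by exists (Submod ker_a); apply: delta_snake; exists (Submod ha).
Qed.

(** Surjectivity of [mu I' i] solves the equation up to a multiple [f * c]; surjectivity of [delta]
    then absorbs [f * c]. *)
Lemma mu_surj_of_delta : surjective (mu I' i) -> surjective delta ->
  surjective (mu I i).
Proof.
move=> sur' surd [y hy].
have [[x' hx'] /(congr1 val) /= ex'] := sur' (Submod (quot_proj_grade _ hy)).
have [a ha ea] := quot_proj_grade_surj hx'.
have hr : y - qpi I (ell K n) * a \in grade I (i + 1).
  by apply: rpredB => //; exact: mu_subproof (Submod ha).
have proj_r0 : quot_proj f (y - qpi I (ell K n) * a) = 0.
  by rewrite linearB /= quot_projMl ea ex' subrr.
have [c + ec] := quot_proj_grade_ker homI hr proj_r0.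
rewrite -degS => hc.
have [x] := surd (quotpi _ (Submod hc)).
have [c' /[dup] [[a' _ ea']] /delta_snake ->] :=
  snake_ex homI (erefl f) (erefl (mdeg g)) x.
move=> /esym/eq_quotpi/asboolP[[b hb] /(congr1 val) /= eb].
(* Here [ell * a = y - f * c], [ell * a' = f * c'] and [ell * b = c - c'], so the errors cancel in
   [ell * w]. *)
pose w := a + val a' + quot_times b.
have hw : w \in grade I i.
  by rewrite !rpredD ?quot_times_grade ?submodP.
exists (Submod hw); apply: val_inj; rewrite /= /w !mulrDr ea' -quot_timesMl eb.
by rewrite linearB /= -ec; ring.
Qed.
End SnakeSequence.

(** All that the chase needs from the edge and vertex cases: [m] is a monomial whose degree is the
    shift [s]. *)
Lemma situation_monomial (K : fieldType) (n : nat) (D D' D'' : {set {set 'I_n}})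
    (m : {mpoly K[n]}) (s : nat) :
  situation D D' D'' m s -> exists2 g, m = 'X_[g] & mdeg g = s.
Proof.
case=> [p q _ _|p _]; last by exists U_(p)%MM; rewrite ?mdeg1.
by exists (U_(p) + U_(q))%MM; rewrite ?mpolyXD ?mdegD ?mdeg1.
Qed.

Theorem proposition2p5 (K : fieldType) (r : nat) (I : ideal {mpoly K[r.+1]})
  (quadI : quadratic_monomial_ideal I) (artA : artinian (quotring I))
  (D' D'' : {set {set 'I_r.+1}}) (m : {mpoly K[r.+1]}) (s : nat)
  (sit : situation (flag_complex I) D' D'' m s) (i : int) :
  (injective (mu (ideal_colon I m) (i - s%:Z)) /\
   injective (delta I m s i) ->
   injective (mu I i)) /\
  (surjective (mu I i) <->
   surjective (mu (ideal_add I m) i) /\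
   surjective (delta I m s i)).
Proof.
have [g -> <-] := situation_monomial sit.
have homI := quad_homog quadI.
split=> [[]|]; first exact: mu_inj_of_delta.
split=> [sur|[]]; last exact: mu_surj_of_delta.
by split; [exact: mu_add_surj | exact: delta_surj].
Qed.
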